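(* Let $p,q\ge 1$ be integers and $n=p+q$. The variety $$ \mathcal S_p=\{(AJ_{p,q}A^{-1}J_{p,q},\,X-AJ_{p,q}A^{-1}X)\,\vert\,(A,X)\in SE(n)\}\subset SE(n) $$ is diffeomorphic to the canonical vector bundle $\mathcal C_{n,p}=\{(\pi,X)\in G(n,p)\times\mathbb{R}^n\,\vert\,X\in\pi\}$ over the Grassmannian $G(n,p)$.
   Context: $SE(n)$ is the Lie group of pairs $(R,X)$, $R\in SO(n)$, $X\in\mathbb{R}^n$, with multiplication $(R_1,X_1)\cdot(R_2,X_2)=(R_1R_2,X_1+R_1X_2)$. $J_{p,q}=\begin{pmatrix}-\mathbb{I}_p&0\\0&\mathbb{I}_q\end{pmatrix}$, where $\mathbb{I}_k$ is the $k\times k$ identity matrix. The set $\mathcal S_p$ is the orbit of the identity $(\mathbb{I}_n,0)$ under the action $g\bullet h=g\cdot h\cdot\sigma(g^{-1})$ of $SE(n)$ on itself, where $\sigma((R,X))=(J_{p,q}RJ_{p,q},J_{p,q}X)$; it is regarded as a submanifold of $SE(n)$. $G(n,p)$ is the Grassmannian manifold of $p$-dimensional linear subspaces of $\mathbb{R}^n$, and $\mathcal C_{n,p}$ carries its usual smooth structure as a vector bundle over $G(n,p)$ (fibre over $\pi$ equal to $\pi$). *)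

(* Defs.v *)
From HB Require Import structures.
From mathcomp Require Import all_boot all_order all_algebra.
From mathcomp Require Import all_classical all_reals all_analysis.

Set Implicit Arguments.
Unset Strict Implicit.
Unset Printing Implicit Defensive.

Import Order.TTheory GRing.Theory Num.Theory.
Import numFieldNormedType.Exports.

Local Open Scope classical_set_scope.
Local Open Scope ring_scope.

(** * Smooth maps between finite-dimensional normed spaces *)

(* For [U] open and finite-dimensional [V], [W]: [f] is [C^k] on [U] iff it is
   differentiable on [U] with all [x |-> Df(x)v] of class [C^(k-1)]. *)
Fixpoint Ck {R : realType} {V W : normedModType R} (k : nat) (U : set V)
    (f : V -> W) : Prop :=
  match k with
  | 0 => forall x, U x -> {for x, continuous f}
  | k'.+1 => (forall x, U x -> differentiable f x) /\
             forall v, Ck k' U (fun x => 'D_v f x)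
  end.

Definition Cinfty {R : realType} {V W : normedModType R} (U : set V)
  (f : V -> W) : Prop := forall k, Ck k U f.

(* Smoothness on an arbitrary subset of a vector space (Milnor, Guillemin and
   Pollack): [f] locally extends to a smooth map of the ambient space. *)
Definition smooth_on_subset {R : realType} {V W : normedModType R} (X : set V)
    (f : V -> W) : Prop :=
  forall x, X x -> exists (O : set V) (F : V -> W),
    [/\ open O, O x, Cinfty O F & forall y, X y -> O y -> f y = F y].

(** * Smooth manifolds *)

(* A local parametrization (inverse chart) of [M]. Only the values of [param]
   on [dom] are relevant. *)
Record chart (R : realType) (d : nat) (M : Type) := Chart {
  dom : set 'rV[R]_d;
  param :> 'rV[R]_d -> M }.

Record charted_space (R : realType) (d : nat) := ChartedSpace {
  points :> topologicalType;
  atlas : set (chart R d points) }.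

Arguments atlas {R d} M _ : rename.

(* [psi^-1 \o f \o phi] is smooth where it is defined; [h] is this composite,
   which is unique there as [psi] is injective on its domain. *)
Definition smooth_in_charts {R : realType} {d e : nat} {M N : Type}
    (f : M -> N) (phi : chart R d M) (psi : chart R e N) : Prop :=
  let W := dom phi `&` (f \o phi) @^-1` (psi @` dom psi) in
  exists h : 'rV[R]_d -> 'rV[R]_e,
    Cinfty W h /\ forall u, W u -> dom psi (h u) /\ psi (h u) = f (phi u).

(* A homeomorphism from an open subset onto an open subset. *)
Definition homeo_chart {R : realType} {d : nat} {M : topologicalType}
    (phi : chart R d M) : Prop :=
  [/\ open (dom phi),
      forall u v, dom phi u -> dom phi v -> phi u = phi v -> u = v,
      forall u, dom phi u -> {for u, continuous phi} &
      forall O : set 'rV[R]_d, open O -> O `<=` dom phi -> open (phi @` O)].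

Definition smooth_manifold {R : realType} {d : nat} (M : charted_space R d)
    : Prop :=
  [/\ hausdorff_space M,
      second_countable (T := M),
      forall phi : chart R d M, atlas M phi -> homeo_chart phi,
      forall x : M, exists2 phi : chart R d M, atlas M phi & (phi @` dom phi) x &
      forall phi psi : chart R d M, atlas M phi -> atlas M psi ->
        smooth_in_charts (@id M) phi psi].

Definition smooth_map {R : realType} {d e : nat} (M : charted_space R d)
    (N : charted_space R e) (f : M -> N) : Prop :=
  continuous f /\
  forall (phi : chart R d M) (psi : chart R e N),
    atlas M phi -> atlas N psi -> smooth_in_charts f phi psi.

(* A charted space need not satisfy the axioms of a smooth manifold, hence the
   first two clauses. *)
Definition diffeomorphic {R : realType} {d e : nat} (M : charted_space R d)
    (N : charted_space R e) : Prop :=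
  [/\ smooth_manifold M, smooth_manifold N &
      exists (f : M -> N) (g : N -> M),
        [/\ cancel f g, cancel g f, smooth_map f & smooth_map g]].

(** * Submanifolds of a vector space *)

(* [phi] is a diffeomorphism from the open set [dom phi] onto an open subset of
   [S], for the subspace topology; [g] is its inverse. *)
Definition submanifold_chart {R : realType} {d : nat} {E : normedModType R}
    (S : set E) (phi : chart R d S) : Prop :=
  let phiE (u : 'rV[R]_d) : E := set_val (phi u) in
  [/\ open (dom phi), open (phi @` dom phi), Cinfty (dom phi) phiE &
      exists2 g : E -> 'rV[R]_d,
        (forall u, dom phi u -> g (phiE u) = u) &
        smooth_on_subset (phiE @` dom phi) g].

(* With this atlas, [S] is a smooth manifold as soon as the charts cover it, and
   it is then an embedded submanifold of [E] of dimension [d], hence also of every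
   submanifold of [E] that contains it. *)
Definition submanifold {R : realType} (d : nat) {E : normedModType R}
    (S : set E) : charted_space R d :=
  ChartedSpace (submanifold_chart (S := S)).

(** * SE(n) and the orbit of the identity *)

Definition SO (R : realType) (n : nat) : set 'M[R]_n :=
  [set A | A *m A^T = 1%:M /\ \det A = 1].

Arguments SO R n _ : clear implicits.

(* SE(n), as a submanifold of the vector space of pairs. *)
Definition SE (R : realType) (n : nat) : set ('M[R]_n * 'cV[R]_n) :=
  [set g | SO R n g.1].

Arguments SE R n _ : clear implicits.

Definition SE_mul {R : realType} {n : nat} (g h : 'M[R]_n * 'cV[R]_n)
    : 'M[R]_n * 'cV[R]_n :=
  (g.1 *m h.1, g.2 + g.1 *m h.2).

Definition SE_one (R : realType) (n : nat) : 'M[R]_n * 'cV[R]_n := (1%:M, 0).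

Definition SE_inv {R : realType} {n : nat} (g : 'M[R]_n * 'cV[R]_n)
    : 'M[R]_n * 'cV[R]_n :=
  (invmx g.1, - (invmx g.1 *m g.2)).

Definition Jpq (R : realType) (p q : nat) : 'M[R]_(p + q) :=
  block_mx (- 1%:M) 0 0 1%:M.

Definition sigma {R : realType} {p q : nat}
    (g : 'M[R]_(p + q) * 'cV[R]_(p + q)) : 'M[R]_(p + q) * 'cV[R]_(p + q) :=
  (Jpq R p q *m g.1 *m Jpq R p q, Jpq R p q *m g.2).

Definition Sp_set (R : realType) (p q : nat)
    : set ('M[R]_(p + q) * 'cV[R]_(p + q)) :=
  let J := Jpq R p q in
  [set (g.1 *m J *m invmx g.1 *m J, g.2 - g.1 *m J *m invmx g.1 *m g.2)
    | g in SE R (p + q)].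

Arguments Sp_set R p q _ : clear implicits.

(* The dimension is that of the Grassmannian plus the rank of the bundle. *)
Definition Sp (R : realType) (p q : nat) : charted_space R (q * p + p) :=
  submanifold (q * p + p) (Sp_set R p q).

Lemma Jpq_sqr (R : realType) (p q : nat) : Jpq R p q *m Jpq R p q = 1%:M.
Proof.
rewrite mulmx_block !mul0mx !mulmx0 mulmxN mulNmx opprK !mulmx1 !addr0 add0r.
by rewrite -scalar_mx_block.
Qed.

Lemma tr_Jpq (R : realType) (p q : nat) : (Jpq R p q)^T = Jpq R p q.
Proof. by rewrite tr_block_mx linearN/= !trmx0 !trmx1. Qed.

Lemma SO_unit (R : realType) (n : nat) (A : 'M[R]_n) : SO R n A -> A \in unitmx.
Proof. by case=> _ dA; rewrite unitmxE dA unitr1. Qed.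

Lemma SO_inv (R : realType) (n : nat) (A : 'M[R]_n) : SO R n A -> invmx A = A^T.
Proof.
move=> /[dup] /SO_unit uA [AAt _].
by rewrite -[LHS]mulmx1 -AAt mulmxA mulVmx// mul1mx.
Qed.

Lemma Sp_sub_SE (R : realType) (p q : nat) : Sp_set R p q `<=` SE R (p + q).
Proof.
move=> _ [[A X] /= SOA <-] /=; have [AAt dA] := SOA.
have AtA : A^T *m A = 1%:M by rewrite -(SO_inv SOA) mulVmx// SO_unit.
rewrite /SE/= (SO_inv SOA); split.
  rewrite !trmx_mul trmxK tr_Jpq !mulmxA -(mulmxA _ (Jpq R p q) (Jpq R p q)).
  rewrite Jpq_sqr mulmx1.
  by rewrite -(mulmxA _ A^T A) AtA mulmx1 -(mulmxA A) Jpq_sqr mulmx1.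
rewrite !det_mulmx det_tr dA mul1r mulr1.
by rewrite -det_mulmx Jpq_sqr det1.
Qed.

Lemma Sp_set_orbit (R : realType) (p q : nat) :
  Sp_set R p q =
  [set SE_mul (SE_mul g (SE_one R (p + q))) (sigma (SE_inv g))
    | g in SE R (p + q)].
Proof.
have e (g : 'M[R]_(p + q) * 'cV[R]_(p + q)) :
    SE_mul (SE_mul g (SE_one R (p + q))) (sigma (SE_inv g)) =
    (g.1 *m Jpq R p q *m invmx g.1 *m Jpq R p q,
     g.2 - g.1 *m Jpq R p q *m invmx g.1 *m g.2).
  rewrite /SE_mul /sigma /= mulmx1 mulmx0 addr0.
  by congr pair; rewrite ?mulmxN -!mulmxA.
by rewrite /Sp_set; apply/eq_imagel => g _; rewrite e.
Qed.

(** * The canonical bundle over the Grassmannian *)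

Definition Grassmannian (R : realType) (n p : nat) : Type :=
  set_type [set V : {vspace 'cV[R]_n} | \dim V = p].

Definition taut_set (R : realType) (n p : nat)
    : set (Grassmannian R n p * 'cV[R]_n) :=
  [set x | x.2 \in (set_val x.1 : {vspace 'cV[R]_n})].

Arguments taut_set R n p _ : clear implicits.

Definition basis_mx (R : realType) (n : nat) : Type :=
  {B : 'M[R]_n | B \in unitmx}.

Section GraphCharts.
Variables (R : realType) (p q : nat) (B : basis_mx R (p + q)).

(* The columns of [B] give a decomposition of the space as P (+) Q, with P
   spanned by the first [p] columns; [A] encodes a linear map from P to Q, and
   [graph_inj A] the map [x |-> x + A x], which identifies P with the graph. *)
Definition graph_inj (A : 'M[R]_(q, p)) (x : 'cV[R]_p) : 'cV[R]_(p + q) :=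
  sval B *m col_mx 1%:M A *m x.

Definition graph_space (A : 'M[R]_(q, p)) : {vspace 'cV[R]_(p + q)} :=
  limg (linfun (mulmx (sval B *m col_mx 1%:M A) : 'cV[R]_p -> _)).

Lemma dim_graph_space A : \dim (graph_space A) = p.
Proof.
rewrite /graph_space limg_dim_eq ?dimvf /dim/= ?muln1//.
apply/eqP; rewrite capfv; apply/lker0P => x y.
rewrite !lfunE/= -!mulmxA => /(can_inj (mulKmx (valP B))).
by rewrite !mul_col_mx !mul1mx => /eq_col_mx[].
Qed.

(* The usual affine chart of the Grassmannian: the subspaces complementary to Q. *)
Definition graph_point (A : 'M[R]_(q, p)) : Grassmannian R (p + q) p :=
  SigSub (mem_set (dim_graph_space A)).

Lemma taut_graph A x : taut_set R (p + q) p (graph_point A, graph_inj A x).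
Proof.
rewrite /taut_set/=.
have -> : graph_inj A x =
  linfun (mulmx (sval B *m col_mx 1%:M A) : 'cV[R]_p -> _) x by rewrite lfunE.
exact: memv_img (memvf x).
Qed.

Definition taut_point (A : 'M[R]_(q, p)) (x : 'cV[R]_p)
    : set_type (taut_set R (p + q) p) :=
  SigSub (mem_set (taut_graph A x)).

(* The local trivialization of the bundle over the above chart. *)
Definition taut_chart : chart R (q * p + p) (set_type (taut_set R (p + q) p)) :=
  Chart setT (fun v => taut_point (vec_mx (lsubmx v)) (rsubmx v)^T).

End GraphCharts.

(* The total space C_(p+q, p). Its topology is the one determined by the local
   trivializations. *)
Definition taut_space (R : realType) (p q : nat) : Type :=
  set_type (taut_set R (p + q) p).

Section TautTopology.
Variables (R : realType) (p q : nat).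

Definition taut_open : set_system (taut_space R p q) :=
  [set W | forall B : basis_mx R (p + q), open (taut_chart B @^-1` W)].

Lemma taut_openT : taut_open setT.
Proof. by move=> B; rewrite preimage_setT; exact: openT. Qed.

Lemma taut_openI : setI_closed taut_open.
Proof. by move=> U V oU oV B; rewrite preimage_setI; exact: openI. Qed.

Lemma taut_open_bigU (I : Type) (f : I -> set (taut_space R p q)) :
  (forall i, taut_open (f i)) -> taut_open (\bigcup_i f i).
Proof.
by move=> of_ B; rewrite preimage_bigcup; apply: bigcup_open => i _; exact: of_.
Qed.

HB.instance Definition _ := gen_eqMixin (taut_space R p q).
HB.instance Definition _ := gen_choiceMixin (taut_space R p q).
HB.instance Definition _ := isOpenTopological.Build (taut_space R p q)
  taut_openT taut_openI taut_open_bigU.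

End TautTopology.

Definition canonical_bundle (R : realType) (p q : nat)
    : charted_space R (q * p + p) :=
  @ChartedSpace R (q * p + p) (taut_space R p q) (range (@taut_chart R p q)).

(* Main.v *)
From HB Require Import structures.
Require Import Defs.
From mathcomp Require Import all_boot all_order all_algebra.
From mathcomp Require Import all_classical all_reals all_analysis.

Set Implicit Arguments.
Unset Strict Implicit.
Unset Printing Implicit Defensive.

Import Order.TTheory GRing.Theory Num.Theory.
Import numFieldNormedType.Exports.

Local Open Scope classical_set_scope.
Local Open Scope ring_scope.

(** If [A] is orthogonal, [A *m J *m A^T] is the reflection [1 - 2 P], where [P]
    is the orthogonal projection onto the span [V] of the first [p] columns of
    [A], and [X - A *m J *m A^T *m X = 2 P X] runs over [V] as [X] varies. Hence a
    point of [S_p] is the same thing as a pair [((1 - 2 P) J, Y)] with [P] an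
    orthogonal projection of rank [p] and [P Y = Y] ([Sp_setP]), and the
    diffeomorphism is [((1 - 2 P) J, Y) |-> (im P, Y)] ([to_bundle]). Every
    orthogonal projection of rank [p] occurs because a [p]-dimensional subspace
    has an orthonormal basis that extends to a positively oriented orthonormal
    basis of the whole space ([gram_schmidt], [SO_completion]).

    For smoothness, fix an invertible [B] and let [N A = B (1; A)], so that the
    columns of [N A] span the graph of [A] in the coordinates given by [B]. The
    projection onto this span is [N (N^T N)^-1 N^T], so the chart [(A, x)] of the
    bundle becomes under the correspondence an explicit smooth map into the
    ambient space of pairs ([sp_param]). If [T] and [D] are the upper and lower
    rows of [B^-1], then [T N = 1] and [D N = A] give

      [T P T^T = (N^T N)^-1],  [D P T^T = A (N^T N)^-1],  [x = T Y],

    and therefore [A = (D P T^T) (T P T^T)^-1]: the inverse of the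
    parametrization is the restriction of a map that is smooth on the open set
    where the [p] by [p] minor [det (T P T^T)] does not vanish, and this set cuts
    out exactly the image of the parametrization ([sp_coordK]). So these
    parametrizations are submanifold charts of [S_p]
    ([sp_chart_submanifold]), and they cover it.

    Since any two submanifold charts are smoothly compatible
    ([submanifold_chart_compatible]), [S_p] is a manifold, and the bijection with
    the bundle, which takes the bundle charts to some of the charts of [S_p],
    transports this structure: it is a homeomorphism and smooth both ways, and
    the manifold axioms for the bundle follow from those of [S_p]
    ([transport_diffeomorphic]). *)

(** * Differential calculus for maps of class C^k *)

Lemma near_eq_differentiable (R : realType) (V W : normedModType R)
    (f g : V -> W) (x : V) :
  (\near x, f x = g x) -> differentiable f x -> differentiable g x.
Proof.
move=> fg df; have fgx : f x = g x := nbhs_singleton fg.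
have /diff_locallyP[cf ef] := df.
suff e : g \o shift x = cst (g x) + 'd f x +o_ 0 id.
  by apply/diff_locallyP; rewrite (diff_unique cf e).
apply/eqaddoP => _/posnumP[e].
have /eqaddoP/(_ e%:num (gt0 e)) ef0 := ef.
have fg0 : \forall h \near (0 : V), f (h + x) = g (h + x).
  by move: fg; rewrite (near_shift 0) /=; apply: filterS => y /=; rewrite subr0.
near=> h; have -> : (g \o shift x - (cst (g x) + 'd f x)) h =
    (f \o shift x - (cst (f x) + 'd f x)) h.
  by rewrite !fctE /= fgx; congr (_ - _); apply/esym; near: h.
by near: h.
Unshelve. all: by end_near. Qed.

Section CkRules.
Context {R : realType}.
Implicit Types V W : normedModType R.

Lemma CkS_Ck V W k (U : set V) (f : V -> W) : Ck k.+1 U f -> Ck k U f.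
Proof.
elim: k f => [|k IH] f.
  by case=> df _ x Ux; exact: differentiable_continuous (df x Ux).
by case=> df Df; split=> // v; exact/IH/Df.
Qed.

Lemma Ck_subset V W k (U U' : set V) (f : V -> W) :
  U' `<=` U -> Ck k U f -> Ck k U' f.
Proof.
move=> UU'; elim: k f => [|k IH] f /=; first by move=> cf x /UU'; exact: cf.
by case=> df Df; split=> [x /UU'|v]; [exact: df|exact/IH/Df].
Qed.

Lemma Ck_local V W k (U : set V) (f : V -> W) :
  (forall x, U x -> exists2 D : set V, D x & Ck k D f) -> Ck k U f.
Proof.
elim: k f => [|k IH] f Of /=.
  by move=> x /Of[D Dx cD]; exact: cD.
split=> [x /Of[D Dx [df _]]|v]; first exact: df.
by apply: IH => x /Of[D Dx [_ Df]]; exists D => //; exact: Df.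
Qed.

Lemma Ck_eq V W k (U : set V) (f g : V -> W) :
  open U -> (forall x, U x -> f x = g x) -> Ck k U f -> Ck k U g.
Proof.
move=> oU; elim: k f g => [|k IH] f g fg.
  move=> cf x Ux; have fgx : \near x, f x = g x.
    by apply: filterS (open_nbhs_nbhs (conj oU Ux)).
  have cfx : f @ x --> f x := cf x Ux.
  change (g @ x --> g x); rewrite -(fg x Ux); apply: cvg_trans cfx.
  exact/near_eq_cvg.
have fgx x : U x -> \near x, f x = g x.
  by move=> Ux; apply: filterS (open_nbhs_nbhs (conj oU Ux)).
case=> df Df; split=> [x Ux|v].
  exact: near_eq_differentiable (fgx x Ux) (df x Ux).
by apply: IH (Df v) => x Ux; exact: near_eq_derive (fgx x Ux).
Qed.

Lemma Ck_cst V W k (U : set V) (a : W) : Ck k U (cst a).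
Proof.
elim: k a => [|k IH] a /=; first by move=> x _; exact: cst_continuous.
split=> [x _|v]; first exact: differentiable_cst.
by rewrite (_ : (fun x => _) = cst 0) //; apply/funext => x; rewrite derive_cst.
Qed.

Lemma derive_comp_lin V V' W (L : {linear V' -> W}) (f : V -> V') x v :
  continuous L -> differentiable f x -> 'D_v (L \o f) x = L ('D_v f x).
Proof.
move=> cL df; have dL y : differentiable L y by exact: linear_differentiable.
rewrite (deriveE _ (differentiable_comp df (dL _))) (deriveE _ df).
by rewrite (diff_comp df (dL _)) /= diff_lin.
Qed.

Lemma Ck_comp_lin V V' W k (U : set V) (L : {linear V' -> W}) (f : V -> V') :
  open U -> continuous L -> Ck k U f -> Ck k U (L \o f).
Proof.
move=> oU cL; elim: k f => [|k IH] f.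
  by move=> cf x Ux; apply: continuous_comp (cf x Ux) (cL _).
case=> df Df; split=> [x Ux|v].
  by apply: differentiable_comp (df x Ux) _; exact: linear_differentiable.
apply: Ck_eq oU _ (IH _ (Df v)) => x Ux /=.
by rewrite (derive_comp_lin _ cL (df x Ux)).
Qed.

Lemma Ck_id V k (U : set V) : Ck k U id.
Proof.
case: k => [|k]; first by move=> x _ ?.
split=> [x _|v]; first by [].
rewrite (_ : (fun x => _) = cst v); first exact: Ck_cst.
by apply/funext => x; rewrite derive_id.
Qed.

Lemma Ck_lin V W k (U : set V) (L : {linear V -> W}) : open U ->
  continuous L -> Ck k U L.
Proof. by move=> oU cL; apply: (Ck_comp_lin oU cL (@Ck_id _ k U)). Qed.

Lemma CkD V W k (U : set V) (f g : V -> W) : open U ->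
  Ck k U f -> Ck k U g -> Ck k U (fun x => f x + g x).
Proof.
move=> oU; elim: k f g => [|k IH] f g.
  by move=> cf cg x Ux; apply: continuousD; [exact: cf|exact: cg].
case=> df Df [dg Dg]; split=> [x Ux|v].
  by apply: differentiableD; [exact: df|exact: dg].
apply: Ck_eq oU _ (IH _ _ (Df v) (Dg v)) => x Ux.
by rewrite (deriveD (diff_derivable (df x Ux)) (diff_derivable (dg x Ux))).
Qed.

Lemma Ck_sum V W k (U : set V) (I : Type) (r : seq I) (P : pred I)
    (f : I -> V -> W) : open U ->
  (forall i, P i -> Ck k U (f i)) ->
  Ck k U (fun x => \sum_(i <- r | P i) f i x).
Proof.
move=> oU Cf; elim: r => [|i r IH].
  rewrite (_ : (fun x => _) = cst 0); first exact: Ck_cst.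
  by apply/funext => x; rewrite big_nil.
case Pi: (P i); last first.
  by apply: Ck_eq oU _ IH => x _; rewrite big_cons Pi.
by apply: Ck_eq oU _ (CkD oU (Cf i Pi) IH) => x _; rewrite big_cons Pi.
Qed.

(** Scalar multiplication is bundled as a bilinear map to use the derivative of
    such maps. *)
Section Scale.
Variable W : normedModType R.

Definition scale_op (a : R) (w : W) : W := a *: w.

Lemma scale_op_bilinear :
  bilinear_for (GRing.Scale.Law.clone _ _ *:%R _)
               (GRing.Scale.Law.clone _ _ *:%R _) scale_op.
Proof.
split=> [w a x y|x a w w'] /=; rewrite /scale_op.
  by rewrite scalerDl scalerA.
by rewrite scalerDr !scalerA mulrC.
Qed.

HB.instance Definition _ := bilinear_isBilinear.Build R R W W _ _ scale_op
  scale_op_bilinear.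

Lemma scale_op_continuous : continuous (fun p : R * W => scale_op p.1 p.2).
Proof. exact: scale_continuous. Qed.

Lemma differentiable_scale V (a : V -> R) (f : V -> W) x :
  differentiable a x -> differentiable f x ->
  differentiable (fun y => a y *: f y) x.
Proof.
move=> da df.
apply: (differentiable_comp (differentiable_pair da df)
  (differentiable_bilin _ scale_op_continuous)).
Qed.

Lemma derive_scale V (a : V -> R) (f : V -> W) x v :
  differentiable a x -> differentiable f x ->
  'D_v (fun y => a y *: f y) x = a x *: 'D_v f x + 'D_v a x *: f x.
Proof.
move=> da df; rewrite (deriveE _ (differentiable_scale da df)) (deriveE _ da).
rewrite (deriveE _ df).
have := diff_comp (differentiable_pair da df)
  (differentiable_bilin (a x, f x) scale_op_continuous).
move=> /(congr1 (@^~ v)); rewrite /comp /= diff_bilin.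
  by rewrite (diff_pair da df).
exact: scale_op_continuous.
Qed.

Lemma Ck_scale V k (U : set V) (a : V -> R) (f : V -> W) : open U ->
  Ck k U a -> Ck k U f -> Ck k U (fun x => a x *: f x).
Proof.
move=> oU; elim: k a f => [|k IH] a f.
  by move=> ca cf x Ux; apply: continuousZ; [exact: ca|exact: cf].
move=> Ca Cf; have [da Da] := Ca; have [df Df] := Cf; split=> [x Ux|v].
  by apply: differentiable_scale; [exact: da|exact: df].
have CaDf := IH _ _ (CkS_Ck Ca) (Df v).
have CfDa := IH _ _ (Da v) (CkS_Ck Cf).
apply: Ck_eq oU _ (CkD oU CaDf CfDa).
by move=> x Ux; rewrite derive_scale //; [exact: da|exact: df].
Qed.

End Scale.

Lemma Ck_mul V k (U : set V) (a b : V -> R) : open U ->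
  Ck k U a -> Ck k U b -> Ck k U (fun x => a x * b x).
Proof. exact: Ck_scale. Qed.

Lemma Ck_prod V k (U : set V) (I : Type) (r : seq I) (f : I -> V -> R) :
  open U -> (forall i, Ck k U (f i)) -> Ck k U (fun x => \prod_(i <- r) f i x).
Proof.
move=> oU Cf; elim: r => [|i r IH].
  rewrite (_ : (fun x => _) = cst 1); first exact: Ck_cst.
  by apply/funext => x; rewrite big_nil.
by apply: Ck_eq oU _ (Ck_mul oU (Cf i) IH) => x _; rewrite big_cons.
Qed.

Lemma Ck_inv V k (U : set V) (a : V -> R) : open U ->
  (forall x, U x -> a x != 0) -> Ck k U a -> Ck k U (fun x => (a x)^-1).
Proof.
move=> oU a0; elim: k => [|k IH].
  by move=> ca x Ux; apply: continuousV; [exact: a0|exact: ca].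
move=> Ca; have [da Da] := Ca; split=> [x Ux|v].
  by apply: differentiableV; [exact: da|exact: a0].
have Cai := IH (CkS_Ck Ca).
have := Ck_mul oU (Ck_mul oU (Ck_cst k U (-1 : R)) (Ck_mul oU Cai Cai)) (Da v).
apply: Ck_eq oU _ => x Ux /=; have dax := da x Ux; have ax0 := a0 x Ux.
rewrite (deriveE _ dax) (deriveE _ (differentiableV dax ax0)) (diffV dax ax0).
by rewrite /= expr2 invfM mulN1r.
Qed.

(** The chain rule only provides the derivative of [g] along a vector that
    depends on the point; expanding that vector over a basis brings it back to
    derivatives of [g] along fixed vectors, hence the coordinates [c] and the
    basis [e]. *)
Lemma Ck_comp V V' W (I : finType) (c : I -> {linear V' -> R}) (e : I -> V')
    (U : set V) (U' : set V') k (f : V -> V') (g : V' -> W) :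
  (forall i, continuous (c i)) -> (forall w, w = \sum_i c i w *: e i) ->
  open U -> open U' -> (forall x, U x -> U' (f x)) ->
  Ck k U f -> Ck k U' g -> Ck k U (g \o f).
Proof.
move=> cc ce oU oU' fU; elim: k f g fU => [|k IH] f g fU Cf Cg.
  by move=> x Ux; exact: continuous_comp (Cf x Ux) (Cg _ (fU x Ux)).
have [df Df] := Cf; have [dg Dg] := Cg; split=> [x Ux|v].
  by apply: differentiable_comp; [exact: df|exact: (dg _ (fU x Ux))].
have Csum : Ck k U (fun x => \sum_i c i ('D_v f x) *: 'D_(e i) g (f x)).
  apply: Ck_sum => // i _; apply: Ck_scale => //.
    exact: (Ck_comp_lin oU (cc i) (Df v)).
  exact: (IH f (fun y => 'D_(e i) g y) fU (CkS_Ck Cf) (Dg (e i))).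
apply: Ck_eq oU _ Csum => x Ux; have dfx := df x Ux; have dgx := dg _ (fU x Ux).
rewrite [RHS](deriveE _ (differentiable_comp dfx dgx)) (diff_comp dfx dgx) /=.
rewrite -(deriveE _ dfx) [in RHS](ce ('D_v f x)) linear_sum.
by apply: eq_bigr => i _; rewrite linearZ /= (deriveE _ dgx).
Qed.

(** ** Matrix-valued maps *)

Definition entry m n (i : 'I_m) (j : 'I_n) (A : 'M[R]_(m, n)) : R := A i j.

Lemma entry_linear m n (i : 'I_m) (j : 'I_n) : linear (@entry m n i j).
Proof. by move=> a A B; rewrite /entry !mxE. Qed.

HB.instance Definition _ m n (i : 'I_m) (j : 'I_n) :=
  GRing.isLinear.Build R 'M[R]_(m, n) R *:%R (entry i j)
    (@entry_linear m n i j).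

Lemma entry_continuous m n (i : 'I_m) (j : 'I_n) : continuous (entry i j).
Proof. exact: coord_continuous. Qed.

Lemma continuous_lin_mx W m n (L : {linear 'M[R]_(m, n) -> W}) : continuous L.
Proof.
pose F (A : 'M[R]_(m, n)) := \sum_i \sum_j A i j *: L (delta_mx i j).
suff C : Ck 0 setT F.
  rewrite (_ : (L : _ -> _) = F); first by move=> A; exact: C.
  apply/funext => A; rewrite [in LHS](matrix_sum_delta A) linear_sum.
  apply: eq_bigr => i _; rewrite linear_sum; apply: eq_bigr => j _.
  by rewrite linearZ.
apply: Ck_sum => [|i _]; first exact: openT.
apply: Ck_sum => [|j _]; first exact: openT.
apply: (@Ck_scale _ _ 0 setT (fun A : 'M[R]_(m, n) => A i j)
  (cst (L (delta_mx i j)))).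
- exact: openT.
- by move=> A _; exact: coord_continuous.
- exact: Ck_cst.
Qed.

Lemma Ck_coord V m n k (U : set V) (f : V -> 'M[R]_(m, n)) i j : open U ->
  Ck k U f -> Ck k U (fun x => f x i j).
Proof.
by move=> oU; apply: (Ck_comp_lin oU (@entry_continuous m n i j)).
Qed.

Lemma Ck_mx V m n k (U : set V) (f : V -> 'M[R]_(m, n)) : open U ->
  (forall i j, Ck k U (fun x => f x i j)) -> Ck k U f.
Proof.
move=> oU Cf.
apply: (@Ck_eq _ _ k U (fun x => \sum_i \sum_j f x i j *: delta_mx i j)) => //.
  by move=> x _; rewrite -matrix_sum_delta.
do 2![apply: Ck_sum => // ? _]; apply: Ck_scale => //; exact: Ck_cst.
Qed.

Lemma Ck_row_mx V m n1 n2 k (U : set V) (f : V -> 'M[R]_(m, n1))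
    (g : V -> 'M[R]_(m, n2)) : open U ->
  Ck k U f -> Ck k U g -> Ck k U (fun x => row_mx (f x) (g x)).
Proof.
move=> oU Cf Cg; apply: Ck_mx => // i j; case: (split_ordP j) => j' ->.
  apply: (@Ck_eq _ _ k U (fun x => f x i j')) => //; last exact: Ck_coord.
  by move=> x _; rewrite row_mxEl.
apply: (@Ck_eq _ _ k U (fun x => g x i j')) => //; last exact: Ck_coord.
by move=> x _; rewrite row_mxEr.
Qed.

Lemma Ck_col_mx V m1 m2 n k (U : set V) (f : V -> 'M[R]_(m1, n))
    (g : V -> 'M[R]_(m2, n)) : open U ->
  Ck k U f -> Ck k U g -> Ck k U (fun x => col_mx (f x) (g x)).
Proof.
move=> oU Cf Cg; apply: Ck_mx => // i j; case: (split_ordP i) => i' ->.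
  apply: (@Ck_eq _ _ k U (fun x => f x i' j)) => //; last exact: Ck_coord.
  by move=> x _; rewrite col_mxEu.
apply: (@Ck_eq _ _ k U (fun x => g x i' j)) => //; last exact: Ck_coord.
by move=> x _; rewrite col_mxEd.
Qed.

Lemma Ck_lin_mx V W m n k (U : set V) (L : {linear 'M[R]_(m, n) -> W})
    (f : V -> 'M[R]_(m, n)) : open U -> Ck k U f -> Ck k U (L \o f).
Proof. by move=> oU; apply: Ck_comp_lin => //; exact: continuous_lin_mx. Qed.

Lemma Ck_mulmx V m n r k (U : set V) (f : V -> 'M[R]_(m, n))
    (g : V -> 'M[R]_(n, r)) : open U ->
  Ck k U f -> Ck k U g -> Ck k U (fun x => f x *m g x).
Proof.
move=> oU Cf Cg; apply: Ck_mx => // i j.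
apply: (@Ck_eq _ _ k U (fun x => \sum_l f x i l * g x l j)) => //.
  by move=> x _; rewrite mxE.
by apply: Ck_sum => // l _; apply: Ck_mul => //; exact: Ck_coord.
Qed.

Lemma Ck_det V n k (U : set V) (f : V -> 'M[R]_n) : open U ->
  Ck k U f -> Ck k U (fun x => \det (f x)).
Proof.
move=> oU Cf; apply: Ck_sum => // s _; apply: Ck_mul => //; first exact: Ck_cst.
by apply: Ck_prod => // i; exact: Ck_coord.
Qed.

(** By Cramer's formula, the entries of the inverse are quotients of polynomials
    in the entries of the matrix. *)
Lemma Ck_invmx V n k (U : set V) (f : V -> 'M[R]_n) : open U ->
  (forall x, U x -> f x \in unitmx) -> Ck k U f ->
  Ck k U (fun x => invmx (f x)).
Proof.
move=> oU uf Cf.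
apply: (@Ck_eq _ _ k U (fun x => (\det (f x))^-1 *: \adj (f x))) => //.
  by move=> x Ux; rewrite /invmx uf.
apply: Ck_scale => //.
  apply: Ck_inv => //; last exact: Ck_det.
  by move=> x /uf; rewrite unitmxE unitfE.
apply: Ck_mx => // i j.
apply: (@Ck_eq _ _ k U
  (fun x => (-1) ^+ (j + i) * \det (row' j (col' i (f x))))) => //.
  by move=> x _; rewrite !mxE.
apply: Ck_mul => //; first exact: Ck_cst.
apply: Ck_det => //; apply: Ck_mx => // a b.
apply: (@Ck_eq _ _ k U (fun x => f x (lift j a) (lift i b))) => //.
  by move=> x _; rewrite !mxE.
exact: Ck_coord.
Qed.

(** ** Maps into and out of products *)

Lemma Ck_pair V W W' k (U : set V) (f : V -> W) (g : V -> W') : open U ->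
  Ck k U f -> Ck k U g -> Ck k U (fun x => (f x, g x)).
Proof.
move=> oU; elim: k f g => [|k IH] f g.
  by move=> cf cg x Ux; apply: cvg_pair; [exact: (cf x Ux)|exact: (cg x Ux)].
case=> df Df [dg Dg]; split=> [x Ux|v].
  exact: differentiable_pair (df x Ux) (dg x Ux).
apply: Ck_eq oU _ (IH _ _ (Df v) (Dg v)) => x Ux.
rewrite [RHS](deriveE _ (differentiable_pair (df x Ux) (dg x Ux))).
rewrite (diff_pair (df x Ux) (dg x Ux)).
by rewrite (deriveE _ (df x Ux)) (deriveE _ (dg x Ux)).
Qed.

Lemma Ck_fst W W' k (U : set (W * W')%type) :
  open U -> Ck k U (fst : W * W' -> W).
Proof.
move=> oU; apply: (@Ck_lin _ _ k U [the {linear (W * W')%type -> W} of fst]).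
  exact: oU.
by move=> x; exact: cvg_fst.
Qed.

Lemma Ck_snd W W' k (U : set (W * W')%type) :
  open U -> Ck k U (snd : W * W' -> W').
Proof.
move=> oU; apply: (@Ck_lin _ _ k U [the {linear (W * W')%type -> W'} of snd]).
  exact: oU.
by move=> x; exact: cvg_snd.
Qed.

End CkRules.

(** Coordinates on the ambient space of [S_p], as the chain rule uses them. *)
Section PairCoordinates.
Context {R : realType} {m n l : nat}.
Local Notation E := ('M[R]_(m, n) * 'cV[R]_l)%type.
Local Notation I := (('I_m * 'I_n) + 'I_l)%type.

Definition pair_coord (i : I) : {linear E -> R} :=
  match i with
  | inl ij => [the {linear E -> R} of entry ij.1 ij.2 \o fst]
  | inr i => [the {linear E -> R} of entry i 0 \o snd]
  end.

Definition pair_basis (i : I) : E :=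
  match i with
  | inl ij => (delta_mx ij.1 ij.2, 0)
  | inr i => (0, delta_mx i 0)
  end.

Lemma pair_coord_continuous i : continuous (pair_coord i).
Proof.
case: i => [[i j]|i] x /=.
  by apply: continuous_comp; [exact: cvg_fst|exact: entry_continuous].
by apply: continuous_comp; [exact: cvg_snd|exact: entry_continuous].
Qed.

Lemma pair_coordE (w : E) : w = \sum_i pair_coord i w *: pair_basis i.
Proof.
rewrite big_sumType /=; apply: injective_projections.
  rewrite (linearD fst) !(linear_sum fst) /= [X in _ + X]big1; last first.
    by move=> i _; rewrite scaler0.
  by rewrite addr0 {1}(matrix_sum_delta w.1) pair_bigA.
rewrite (linearD snd) !(linear_sum snd) /= [X in X + _]big1; last first.
  by move=> i _; rewrite scaler0.
rewrite add0r {1}(matrix_sum_delta w.2); apply: eq_bigr => i _.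
by rewrite big_ord1.
Qed.

End PairCoordinates.
(** * Topology of submanifolds *)

Lemma open_setI_preimage (X Y : topologicalType) (U : set X) (V : set Y)
    (f : X -> Y) :
  open U -> open V -> (forall x, U x -> {for x, continuous f}) ->
  open (U `&` f @^-1` V).
Proof.
move=> oU oV cf; rewrite openE => x [Ux Vfx]; rewrite /interior.
apply: filterI; first exact: open_nbhs_nbhs.
by apply: (cf x Ux); exact: open_nbhs_nbhs.
Qed.

Lemma hausdorff_inj (X Y : topologicalType) (f : X -> Y) :
  injective f -> continuous f -> hausdorff_space Y -> hausdorff_space X.
Proof.
move=> fI cf hY x y clxy; apply/fI/hY => A B nA nB.
have [z [Az Bz]] := clxy _ _ (cf x A nA) (cf y B nB).
by exists (f z).
Qed.

Lemma second_countable_homeo (X Y : topologicalType) (f : X -> Y) (g : Y -> X) :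
  cancel f g -> continuous f -> continuous g ->
  second_countable (T := Y) -> second_countable (T := X).
Proof.
move=> fK cf cg [B cB [oB bB]]; exists ((fun U => f @^-1` U) @` B).
  exact: card_le_trans (card_image_le _ _) cB.
split=> [_ [U BU <-]|x V nV].
  by apply: open_comp => [y _|]; [exact: cf|exact: oB].
have nfV : nbhs (f x) (g @^-1` V) by apply: cg; rewrite fK.
have [U [BU Ufx] UV] := bB (f x) _ nfV.
exists (f @^-1` U); first by split=> //; exists U.
by move=> y Ufy; rewrite -(fK y); exact: UV.
Qed.

(** The balls of radius [1 / k.+1] centred on a countable dense subset of the
    ambient space, whose centres need not lie in [S]. *)
Lemma second_countable_set_type (R : realType) (E : pseudoMetricType R)
    (T : countType) (q : T -> E) (S : set E) :
  (forall x e, 0 < e -> exists t, ball (q t) e x) -> second_countable (T := S).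
Proof.
move=> qD; pose U (i : T * nat) : set S :=
  set_val @^-1` (ball (q i.1) i.2.+1%:R^-1)°.
exists (range U); first exact: card_le_trans (card_image_le _ _) (countableP _).
split=> [_ [i _ <-]|x V].
  by exists (ball (q i.1) i.2.+1%:R^-1)° => //; exact: open_interior.
case=> _ [[A oA <-] Ax] AV.
have /nbhs_ballP[e /= e0 eA] := open_nbhs_nbhs (conj oA Ax).
have [k ke] := ltr_add_invr (divr_gt0 e0 (ltr0n R 2)).
rewrite add0r in ke.
have k0 : (0 : R) < k.+1%:R^-1 by rewrite invr_gt0 ltr0n.
have [t tx] := qD (set_val x) (k.+1%:R^-1 / 2) (divr_gt0 k0 (ltr0n R 2)).
exists (U (t, k)).
  split; first by exists (t, k).
  apply/nbhs_ballP; exists (k.+1%:R^-1 / 2) => /=; first by rewrite divr_gt0.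
  by move=> y xy; rewrite [_^-1]splitr; apply: ball_triangle xy.
move=> y /interior_subset ty; apply/AV/eA; rewrite [e]splitr.
apply: (@ball_triangle _ _ (q t)); last exact: le_ball (ltW ke) _ ty.
apply: ball_sym; apply: le_ball tx; apply: le_trans (ltW ke).
by rewrite ler_pdivrMr // ler_peMr ?ler1n // ltW.
Qed.

Lemma ratr_mx_dense (R : realType) m n (A : 'M[R]_(m, n)) (e : R) : 0 < e ->
  exists Q : 'M[rat]_(m, n), ball (map_mx ratr Q : 'M[R]_(m, n)) e A.
Proof.
move=> e0; have dQ i j : exists r : rat, ball (ratr r : R) e (A i j).
  have [x [/= Ar [r _ rx]]] := @dense_rat R (ball (A i j) e)
    (ex_intro _ _ (ballxx (A i j) e0)) (ball_open (A i j) e).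
  by exists r; rewrite rx; exact: ball_sym.
exists (\matrix_(i, j) projT1 (cid (dQ i j))); split=> // i j.
by rewrite !mxE; exact: projT2 (cid (dQ i j)).
Qed.

Lemma ratr_pair_dense (R : realType) m n l (x : 'M[R]_(m, n) * 'cV[R]_l)
    (r : R) :
  0 < r -> exists t : 'M[rat]_(m, n) * 'cV[rat]_l,
    ball ((map_mx ratr t.1, map_mx ratr t.2) : 'M[R]_(m, n) * 'cV[R]_l) r x.
Proof.
case: x => A x r0.
have [Q AQ] := ratr_mx_dense A r0; have [y xy] := ratr_mx_dense x r0.
by exists (Q, y).
Qed.

(** * Submanifolds are manifolds *)

Section Submanifold.
Context {R : realType} {d : nat} {E : normedModType R} (S : set E).
Implicit Types phi psi : chart R d S.

Lemma set_val_continuous : continuous (set_val : S -> E).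
Proof. exact: initial_continuous. Qed.

(** [phi] is open because its inverse is locally the restriction of a continuous
    map of the ambient space. *)
Lemma submanifold_chart_homeo phi : submanifold_chart phi -> homeo_chart phi.
Proof.
case=> oD oI Cphi [g gK sg]; split=> //.
- by move=> u v Du Dv euv; rewrite -(gK u Du) euv gK.
- move=> u Du V [_ [[A oA <-] Au] AV].
  have nA := Cphi 0%N u Du A (open_nbhs_nbhs (conj oA Au)).
  by apply: (@filterS _ (nbhs u) _ _ (phi @^-1` V) _ nA) => w; exact: AV.
move=> B oB BD; rewrite openE => _ [u Bu <-]; rewrite /interior.
have Du := BD u Bu.
have [A [F [oA Au CF gF]]] := sg (set_val (phi u)) (ex_intro2 _ _ u Du erefl).
have Fu : F (set_val (phi u)) = u by rewrite -gF ?gK//; exists u.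
have nF : nbhs (set_val (phi u)) (A `&` F @^-1` B).
  apply: filterI; first exact: open_nbhs_nbhs.
  by apply: (CF 0%N _ Au); rewrite Fu; exact: open_nbhs_nbhs.
have nS : nbhs (phi u) (phi @` dom phi).
  by apply: open_nbhs_nbhs; split=> //; exists u.
have nI : nbhs (phi u)
    (phi @` dom phi `&` set_val @^-1` (A `&` F @^-1` B)).
  by apply: filterI nS _; exact: set_val_continuous nF.
apply: (@filterS _ (nbhs (phi u)) _ _ (phi @` B) _ nI).
move=> x [[v Dv <-] [Av Bv]]; exists v => //.
by move: Bv; rewrite /= -gF ?gK//; exists v.
Qed.

(** The change of charts is the ambient inverse of [psi] after the ambient map
    [phi], and so smooth by the chain rule, which asks for the linear
    coordinates [c] and the basis [e]. *)
Lemma submanifold_chart_compatible (I : finType) (c : I -> {linear E -> R})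
    (e : I -> E) phi psi :
  (forall i, continuous (c i)) -> (forall w, w = \sum_i c i w *: e i) ->
  submanifold_chart phi -> submanifold_chart psi ->
  smooth_in_charts (@id S) phi psi.
Proof.
move=> cc ce sphi spsi.
have [oD _ Cphi _] := sphi; have [_ oI _ [g gK sg]] := spsi.
pose W := dom phi `&` (id \o phi) @^-1` (psi @` dom psi).
have oW : open W.
  apply: (@open_setI_preimage _ _ _ _ phi) oD oI _.
  by have [] := submanifold_chart_homeo sphi.
exists (fun u => g (set_val (phi u))); split; last first.
  by move=> u [Du [v Dv /= ev]]; rewrite -ev gK.
move=> k; apply: Ck_local => u [Du [v Dv /= ev]].
have [A [F [oA Au CF gF]]] := sg (set_val (phi u))
  (ex_intro2 _ _ v Dv (congr1 set_val ev)).
pose N := W `&` (fun u => set_val (phi u)) @^-1` A.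
have oN : open N.
  by apply: open_setI_preimage => // w [Dw _]; exact: (Cphi 0%N w Dw).
exists N; first by split=> //; split=> //; exists v.
have CF' : Ck k N (F \o (fun u => set_val (phi u))).
  apply: (Ck_comp cc ce oN oA (U' := A)) => //; first by move=> w [].
  by apply: Ck_subset (Cphi k) => w [[]].
apply: Ck_eq oN _ CF' => w [[Dw [z Dz /= ez]] Aw] /=.
by rewrite gF //; exists z => //; rewrite ez.
Qed.

Lemma submanifold_smooth (I : finType) (c : I -> {linear E -> R}) (e : I -> E)
    (T : countType) (q : T -> E) :
  (forall i, continuous (c i)) -> (forall w, w = \sum_i c i w *: e i) ->
  (forall x r, 0 < r -> exists t, ball (q t) r x) ->
  (forall x : S, exists2 phi : chart R d S,
     submanifold_chart phi & (phi @` dom phi) x) ->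
  smooth_manifold (submanifold d S).
Proof.
move=> cc ce qD cover; split=> //.
- apply: (@hausdorff_inj S E set_val) (@norm_hausdorff _ _).
    exact: val_inj.
  exact: set_val_continuous.
- exact: second_countable_set_type qD.
- exact: submanifold_chart_homeo.
- by move=> phi psi; exact: submanifold_chart_compatible cc ce.
Qed.

End Submanifold.

(** * Transport of a smooth structure *)

Definition push_chart (R : realType) d (M N : Type) (f : M -> N)
    (phi : chart R d M) : chart R d N := Chart (dom phi) (f \o phi).

(** A homeomorphism that sends every chart of an atlas covering [X] to a chart
    of the manifold [M] makes [X] a manifold: read in charts, it and its inverse
    are changes of charts of [M]. *)
Lemma transport_diffeomorphic (R : realType) d (M X : charted_space R d)
    (f : M -> X) (g : X -> M) :
  smooth_manifold M -> cancel f g -> cancel g f ->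
  continuous f -> continuous g ->
  (forall phi, atlas X phi -> atlas M (push_chart g phi)) ->
  (forall x : X, exists2 phi, atlas X phi & (phi @` dom phi) x) ->
  diffeomorphic M X.
Proof.
move=> sM fK gK cf cg gA cover; have [hM cM homM covM compM] := sM.
have imE phi x : (phi @` dom phi) (f x) <->
    (push_chart g phi @` dom (push_chart g phi)) x.
  split=> -[u Du /= e]; exists u => //; first by rewrite /= e fK.
  by rewrite -e gK.
split=> //; first split=> //.
- exact: hausdorff_inj (can_inj gK) cg hM.
- exact: second_countable_homeo gK cg cf cM.
- move=> phi /gA/homM[/= oD inj cphi ophi]; split=> //.
  + by move=> u v Du Dv euv; apply: inj => //=; rewrite euv.
  + move=> u Du; rewrite (_ : (phi : _ -> _) = f \o (g \o phi)).
      exact: continuous_comp (cphi u Du) (cf _).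
    by apply/funext => w /=; rewrite gK.
  + move=> U oU UD; rewrite (_ : phi @` U = g @^-1` ((g \o phi) @` U)).
      by apply: open_comp => [x _|]; [exact: cg|exact: ophi].
    apply/seteqP; split=> [_ [u Uu <-]|x [u Uu /= /(can_inj gK) <-]];
      by exists u.
- move=> phi psi /gA Aphi /gA Apsi.
  have [h [Ch hE]] := compM _ _ Aphi Apsi.
  exists h.
  have WE : dom phi `&` (id \o phi) @^-1` (psi @` dom psi) =
      dom (push_chart g phi) `&` (id \o push_chart g phi) @^-1`
        (push_chart g psi @` dom (push_chart g psi)).
    rewrite eqEsubset; split=> u [Du /= Iu]; split=> //=.
      by apply/imE; rewrite gK.
    by move/imE: Iu; rewrite gK.
  rewrite WE; split=> // u /hE[Dh /= e]; split=> //.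
  exact: can_inj gK _ _ e.
exists f, g; split=> //; split=> //.
- move=> phi psi Aphi /gA Apsi; have [h [Ch hE]] := compM _ _ Aphi Apsi.
  exists h.
  have WE : dom phi `&` (f \o phi) @^-1` (psi @` dom psi) =
      dom phi `&` (id \o phi) @^-1`
        (push_chart g psi @` dom (push_chart g psi)).
    by rewrite eqEsubset; split=> u [Du /imE Iu]; split=> //; exact/imE.
  rewrite WE; split=> // u /hE[Dh /= e]; split=> //.
  by rewrite -e gK.
- by move=> phi psi /gA Aphi Apsi; exact: compM Aphi Apsi.
Qed.
(** * Orthogonal projections *)

Section OrthogonalProjections.
Context {R : rcfType}.

(** Over an ordered field, a vanishing sum of squares has vanishing terms. *)
Lemma mulmx_tr_eq0 n (w : 'rV[R]_n) : w *m w^T = 0 -> w = 0.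
Proof.
move=> /matrixP/(_ 0 0); rewrite !mxE => /eqP.
rewrite psumr_eq0 => [/allP w0|i _]; last by rewrite mxE -expr2 sqr_ge0.
apply/rowP => i; have := w0 i (mem_index_enum _).
by rewrite !mxE mulf_eq0 orbb => /eqP.
Qed.

Lemma mulmx_tr_gt0 n (w : 'rV[R]_n) : w != 0 -> 0 < (w *m w^T) 0 0.
Proof.
move=> w0; rewrite lt_def; apply/andP; split; last first.
  by rewrite mxE; apply: sumr_ge0 => i _; rewrite mxE -expr2 sqr_ge0.
apply: contra_neq w0 => ww; apply: mulmx_tr_eq0; apply/matrixP => i j.
by rewrite !ord1 ww mxE.
Qed.

(** By induction on the number of rows: orthogonalize the first row against an
    orthonormal basis of the others, then normalize it. *)
Lemma gram_schmidt m n (M : 'M[R]_(m, n)) : row_free M ->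
  exists2 Q : 'M[R]_(m, n), Q *m Q^T = 1%:M & (Q :=: M)%MS.
Proof.
elim: m M => [|m IH] M fM.
  by exists M => //; apply/matrixP => -[].
rewrite -[m.+1]/(1 + m)%N in M fM *.
pose r := usubmx M; pose M' := dsubmx M.
have eM : M = col_mx r M' by rewrite vsubmxK.
have fM' : row_free M'.
  apply: inj_row_free => v vM'.
  have : row_mx 0 v *m M = 0 by rewrite eM mul_row_col mul0mx add0r.
  by move/eqP; rewrite mulmx_free_eq0 // -(row_mx0 R 1 1 m) => /eqP/eq_row_mx[].
have [Q' QQ' eQ'] := IH M' fM'.
pose s := r - r *m Q'^T *m Q'.
have sQ' : s *m Q'^T = 0 by rewrite mulmxBl -!mulmxA QQ' mulmx1 subrr.
have s0 : s != 0.
  apply/eqP => s0; have /submxP[D rD] : (r <= M')%MS.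
    by rewrite -eQ' -(subrK (r *m Q'^T *m Q') r) -/s s0 add0r submxMl.
  have : row_mx 1%:M (- D) *m M = 0.
    by rewrite eM mul_row_col mul1mx mulNmx -rD subrr.
  move/eqP; rewrite mulmx_free_eq0 // -(row_mx0 R 1 1 m) => /eqP/eq_row_mx[e _].
  by have /eqP := congr1 (fun A : 'M[R]_1 => A 0 0) e; rewrite !mxE oner_eq0.
have a0 := mulmx_tr_gt0 s0; set a := (s *m s^T) 0 0 in a0.
pose u := (Num.sqrt a)^-1 *: s.
have b0 : (Num.sqrt a)^-1 != 0 by rewrite invr_eq0 sqrtr_eq0 -ltNge.
exists (col_mx u Q').
  rewrite tr_col_mx mul_col_row QQ'.
  have uQ' : u *m Q'^T = 0 by rewrite -scalemxAl sQ' scaler0.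
  have Q'u : Q' *m u^T = 0 by rewrite -[LHS]trmxK trmx_mul trmxK uQ' trmx0.
  rewrite uQ' Q'u (_ : u *m u^T = 1%:M) -?scalar_mx_block //.
  rewrite linearZ /= -scalemxAl -scalemxAr scalerA [s *m s^T]mx11_scalar -/a.
  by rewrite scale_scalar_mx -invfM -expr2 sqr_sqrtr ?ltW // mulVf // gt_eqF.
have e : (s + Q' :=: r + M')%MS.
  apply: eqmx_trans (adds_eqmx (eqmx_refl r) eQ').
  apply/eqmxP/andP; split; rewrite addsmx_sub addsmxSr andbT.
    rewrite /s addmx_sub ?addsmxSl // -mulNmx.
    by apply: submx_trans (submxMl _ _) (addsmxSr _ _).
  rewrite -(subrK (r *m Q'^T *m Q') r) -/s addmx_sub ?addsmxSl //.
  by apply: submx_trans (submxMl _ _) (addsmxSr _ _).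
apply: eqmx_trans (eqmx_sym (addsmxE _ _)) _; rewrite eM.
apply: eqmx_trans _ (addsmxE _ _); apply: eqmx_trans _ e.
exact: adds_eqmx (eqmx_scale _ b0) (eqmx_refl _).
Qed.

Lemma gram_unitmx m n (M : 'M[R]_(m, n)) : row_free M -> M *m M^T \in unitmx.
Proof.
move=> fM; rewrite -row_free_unit; apply: inj_row_free => v vMM.
apply/eqP; rewrite -(mulmx_free_eq0 _ fM); apply/eqP/mulmx_tr_eq0.
by rewrite trmx_mul mulmxA -(mulmxA v) vMM mul0mx.
Qed.

(** The matrices of orthogonal projections. *)
Definition symproj n (P : 'M[R]_n) := P^T = P /\ P *m P = P.

(** Each projection fixes the row space of the other, so [P *m Q = P] and
    [Q *m P = Q]; transposing the first identity gives [Q *m P = P]. *)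
Lemma symproj_eqmx n (P Q : 'M[R]_n) :
  symproj P -> symproj Q -> (P :=: Q)%MS -> P = Q.
Proof.
move=> [tP PP] [tQ QQ] ePQ.
have PQ : P *m Q = P.
  have /submxP[D ->] : (P <= Q)%MS by rewrite ePQ.
  by rewrite -mulmxA QQ.
have QP : Q *m P = Q.
  have /submxP[D ->] : (Q <= P)%MS by rewrite ePQ.
  by rewrite -mulmxA PP.
by rewrite -PQ -[LHS]trmxK trmx_mul tP tQ QP tQ.
Qed.

(** The orthogonal projection onto the span of the rows of [M], when these are
    linearly independent. *)
Definition orthoproj m n (M : 'M[R]_(m, n)) : 'M[R]_n :=
  M^T *m invmx (M *m M^T) *m M.

Lemma orthoprojK m n (M : 'M[R]_(m, n)) : row_free M -> M *m orthoproj M = M.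
Proof.
by move=> fM; rewrite /orthoproj !mulmxA mulmxV ?mul1mx ?gram_unitmx.
Qed.

Lemma orthoproj_symproj m n (M : 'M[R]_(m, n)) :
  row_free M -> symproj (orthoproj M).
Proof.
move=> fM; split; last by rewrite {1}/orthoproj -!mulmxA orthoprojK // mulmxA.
by rewrite !trmx_mul trmxK trmx_inv trmx_mul trmxK mulmxA.
Qed.

Lemma orthoproj_eqmx m n (M : 'M[R]_(m, n)) :
  row_free M -> (orthoproj M :=: M)%MS.
Proof.
move=> fM; apply/eqmxP/andP; split; first exact: submxMl.
by rewrite -{1}(orthoprojK fM) submxMl.
Qed.

Lemma orthoproj_uniq m n (M : 'M[R]_(m, n)) P :
  row_free M -> symproj P -> (P :=: M)%MS -> orthoproj M = P.
Proof.
move=> fM sP eP; apply: symproj_eqmx => //; first exact: orthoproj_symproj.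
exact: eqmx_trans (orthoproj_eqmx fM) (eqmx_sym eP).
Qed.

Lemma orth_symproj m n (Q : 'M[R]_(m, n)) : Q *m Q^T = 1%:M ->
  [/\ row_free Q, symproj (Q^T *m Q) & (Q^T *m Q :=: Q)%MS].
Proof.
move=> QQ; have fQ : row_free Q by apply/row_freeP; exists Q^T.
have e : orthoproj Q = Q^T *m Q by rewrite /orthoproj QQ invmx1 mulmx1.
by rewrite -e; split=> //; [exact: orthoproj_symproj|exact: orthoproj_eqmx].
Qed.

Lemma row_free_base_of_rank m n r (K : 'M[R]_(m, n)) : \rank K = r ->
  exists2 N : 'M[R]_(r, n), row_free N & (N :=: K)%MS.
Proof.
by move=> <-; exists (row_base K); [exact: row_base_free|exact: eq_row_base].
Qed.

(** Gram-Schmidt on [M] and on its orthogonal complement gives an orthogonal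
    matrix; the sign of its determinant is corrected by flipping one basis
    vector, which requires [0 < p]. *)
Lemma SO_completion p q (M : 'M[R]_(p, p + q)) : (0 < p)%N -> row_free M ->
  exists A : 'M[R]_(p + q),
    [/\ A *m A^T = 1%:M, \det A = 1 & (usubmx A^T :=: M)%MS].
Proof.
move=> p0 fM; have [Q1 QQ1 eQ1] := gram_schmidt fM.
have rK : \rank (kermx Q1^T) = q.
  rewrite mxrank_ker mxrank_tr eQ1.
  by move: fM; rewrite /row_free => /eqP ->; rewrite addKn.
have [N fN eN] := row_free_base_of_rank rK.
have [Q2 QQ2 eQ2] := gram_schmidt fN.
have Q21 : Q2 *m Q1^T = 0 by apply/sub_kermxP; rewrite eQ2 eN.
have Q12 : Q1 *m Q2^T = 0 by rewrite -[LHS]trmxK trmx_mul trmxK Q21 trmx0.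
pose C := col_mx Q1 Q2.
have CC : C *m C^T = 1%:M.
  by rewrite tr_col_mx mul_col_row QQ1 QQ2 Q12 Q21 -scalar_mx_block.
have dC : \det C = 1 \/ \det C = -1.
  have := congr1 determinant CC; rewrite det_mulmx det_tr det1 => /eqP.
  by rewrite -expr2 sqrf_eq1 => /orP[] /eqP ->; [left|right].
have orth (B : 'M[R]_(p + q)) : B *m B^T = 1%:M -> B^T *m B^T^T = 1%:M.
  by move=> BB; rewrite trmxK; apply: mulmx1C.
case: dC => dC.
  exists C^T; split; [exact: orth|by rewrite det_tr|].
  by rewrite trmxK col_mxKu.
pose d := \row_(i < p) (if i == Ordinal p0 then -1 else 1 : R).
pose B : 'M[R]_(p + q) := block_mx (diag_mx d) 0 0 1%:M.
have dd : diag_mx d *m diag_mx d = 1%:M.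
  rewrite mulmx_diag -diag_const_mx; congr diag_mx; apply/rowP => i.
  by rewrite !mxE; case: eqP; rewrite ?mulrNN mulr1.
have BB : B *m B = 1%:M.
  rewrite mulmx_block !mulmx0 !mul0mx !addr0 !add0r dd mulmx1.
  by rewrite -scalar_mx_block.
have tB : B^T = B by rewrite tr_block_mx !trmx0 trmx1 tr_diag_mx.
have dB : \det B = -1.
  rewrite det_ublock det1 mulr1 det_diag (bigD1 (Ordinal p0)) //= big1.
    by rewrite mxE eqxx mulr1.
  by move=> i; rewrite mxE => /negbTE ->.
exists (B *m C)^T; split.
- apply: orth; rewrite trmx_mul tB !mulmxA -(mulmxA B) CC mulmx1; exact: BB.
- by rewrite det_tr det_mulmx dB dC mulrNN mulr1.
rewrite trmxK mul_block_col !mul0mx addr0 col_mxKu.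
apply: eqmx_trans eQ1; apply: eqmxMfull.
by rewrite row_full_unit; case/mulmx1_unit: dd.
Qed.

(** ** Subspaces as column spaces *)

Lemma mem_limg_mulmx n r (K : 'M[R]_(n, r)) (v : 'cV[R]_n) :
  (v \in limg (linfun (mulmx K : 'cV_r -> 'cV_n))) = (v^T <= K^T)%MS.
Proof.
apply/memv_imgP/submxP => [[u _ ->]|[D e]].
  by exists u^T; rewrite lfunE /= trmx_mul.
exists D^T; first exact: memvf.
by rewrite lfunE /= -[v]trmxK e trmx_mul trmxK.
Qed.

Lemma eq_limg_mulmx n r s (K : 'M[R]_(n, r)) (L : 'M[R]_(n, s)) :
  (K^T :=: L^T)%MS ->
  limg (linfun (mulmx K : 'cV_r -> 'cV_n)) =
  limg (linfun (mulmx L : 'cV_s -> 'cV_n)).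
Proof. by move=> e; apply/vspaceP => v; rewrite !mem_limg_mulmx e. Qed.

Lemma limg_mulmx_inj n r s (K : 'M[R]_(n, r)) (L : 'M[R]_(n, s)) :
  limg (linfun (mulmx K : 'cV_r -> 'cV_n)) =
  limg (linfun (mulmx L : 'cV_s -> 'cV_n)) -> (K^T :=: L^T)%MS.
Proof.
move=> /vspaceP e; apply/eqmxP/andP; split; apply/row_subP => i;
  rewrite -[row i _]trmxK -mem_limg_mulmx.
  by rewrite -e mem_limg_mulmx trmxK row_sub.
by rewrite e mem_limg_mulmx trmxK row_sub.
Qed.

Lemma dim_limg_mulmx n r (K : 'M[R]_(n, r)) :
  \dim (limg (linfun (mulmx K : 'cV_r -> 'cV_n))) = \rank K.
Proof.
have [N fN eN] := row_free_base_of_rank (erefl (\rank K^T)).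
rewrite -mxrank_tr (@eq_limg_mulmx _ _ _ _ N^T) ?trmxK //; last exact: eqmx_sym.
rewrite limg_dim_eq ?dimvf /dim /= ?muln1 //.
apply/eqP; rewrite capfv; apply/lker0P => x y.
rewrite !lfunE /= => /(congr1 trmx); rewrite !trmx_mul trmxK.
by move/(row_free_inj fN)/(congr1 trmx); rewrite !trmxK.
Qed.

Lemma vspace_limg_mulmx n (V : {vspace 'cV[R]_n}) :
  exists K : 'M[R]_n, V = limg (linfun (mulmx K : 'cV_n -> 'cV_n)).
Proof.
pose K : 'M[R]_n := \matrix_(i, j) projv V (delta_mx j 0) i 0.
have KE u : K *m u = projv V u.
  apply/colP => i; rewrite {2}(matrix_sum_delta u) linear_sum summxE !mxE.
  by apply: eq_bigr => j _; rewrite big_ord1 linearZ !mxE mulrC.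
exists K; apply/vspaceP => v; apply/idP/memv_imgP => [Vv|[u _ ->]].
  by exists v; [exact: memvf|rewrite lfunE /= KE projv_id].
by rewrite lfunE /= KE memv_proj.
Qed.

End OrthogonalProjections.
(** * The manifold S_p *)

Section SpBundle.
Context {R : realType} {p q : nat}.
Local Notation n := (p + q)%N.
Local Notation E := ('M[R]_n * 'cV[R]_n)%type.
Local Notation J := (Jpq R p q).

(** Solves [g.1 = (1 - 2 P) *m J] for [P]. *)
Definition sp_proj (g : E) : 'M[R]_n := 2^-1 *: (1%:M - g.1 *m J).

Definition refl_mx (P : 'M[R]_n) : 'M[R]_n := (1%:M - 2 *: P) *m J.

Lemma two_neq0 : (2 : R) != 0. Proof. by rewrite pnatr_eq0. Qed.

Lemma sp_projK (P : 'M[R]_n) X : sp_proj (refl_mx P, X) = P.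
Proof.
rewrite /sp_proj /refl_mx /= -mulmxA Jpq_sqr mulmx1 opprB addrC subrK scalerA.
by rewrite mulVf ?two_neq0 // scale1r.
Qed.

Lemma refl_mxK (g : E) : refl_mx (sp_proj g) = g.1.
Proof.
rewrite /refl_mx /sp_proj scalerA mulfV ?two_neq0 // scale1r opprB addrC subrK.
by rewrite -mulmxA Jpq_sqr mulmx1.
Qed.

Definition proj_first : 'M[R]_n := block_mx 1%:M 0 0 0.

Lemma JpqE : J = 1%:M - 2 *: proj_first.
Proof.
rewrite /Jpq /proj_first (scalar_mx_block p q) scale_block_mx opp_block_mx.
rewrite add_block_mx !scaler0 !oppr0 !addr0; congr block_mx.
by rewrite scaler_nat mulr2n opprD addrA subrr add0r.
Qed.

Lemma conj_proj_first (A : 'M[R]_n) :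
  A *m proj_first *m A^T = (usubmx A^T)^T *m usubmx A^T.
Proof.
rewrite -{1}(trmxK A) -{1 2}(vsubmxK A^T) tr_col_mx mul_row_block.
by rewrite mulmx1 !mulmx0 !addr0 mul_row_col mul0mx addr0.
Qed.

Lemma conj_Jpq (A : 'M[R]_n) : A *m A^T = 1%:M ->
  A *m J *m A^T = 1%:M - 2 *: (A *m proj_first *m A^T).
Proof.
by move=> AA; rewrite JpqE mulmxBr mulmxBl mulmx1 AA -!scalemxAr -scalemxAl.
Qed.

Lemma usubmx_orth (A : 'M[R]_n) :
  A *m A^T = 1%:M -> usubmx A^T *m (usubmx A^T)^T = 1%:M.
Proof.
move=> /mulmx1C; rewrite -{2}(trmxK A); move: A^T => C.
rewrite -{1 2}(vsubmxK C) tr_col_mx mul_col_row (scalar_mx_block p q).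
by case/eq_block_mx.
Qed.

(** A point [((1 - 2 P) J, 2 P X)] of [S_p] visibly has these properties. For
    the converse, complete an orthonormal basis of the image of the projection
    to an element of [SO n]; the factor [2] is absorbed by [X = g.2 / 2]. *)
Lemma Sp_setP (p0 : (0 < p)%N) (g : E) : Sp_set R p q g <->
  [/\ symproj (sp_proj g), \rank (sp_proj g) = p & sp_proj g *m g.2 = g.2].
Proof.
split=> [[[A X] /= SOA <-]|[sP rP Pg]].
  have [AA dA] := SOA; rewrite (SO_inv SOA) (conj_Jpq AA) conj_proj_first.
  set Q := usubmx A^T.
  have [fQ sQ eQ] := orth_symproj (usubmx_orth AA).
  rewrite -/(refl_mx _) sp_projK /=.
  have -> : X - (1%:M - 2 *: (Q^T *m Q)) *m X = 2 *: (Q^T *m Q *m X).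
    by rewrite mulmxBl mul1mx opprB addrC subrK -scalemxAl.
  split=> //; first by rewrite eQ; exact/eqP.
  by rewrite -scalemxAr mulmxA; have [_ ->] := sQ.
have [N fN eN] := row_free_base_of_rank rP.
have [A [AA dA eA]] := SO_completion p0 fN.
have SOA : SO R n A by [].
have [fQ sQ eQ] := orth_symproj (usubmx_orth AA).
have eP : (usubmx A^T)^T *m usubmx A^T = sp_proj g.
  apply: symproj_eqmx => //.
  exact: eqmx_trans eQ (eqmx_trans eA eN).
exists (A, 2^-1 *: g.2) => //=.
rewrite (SO_inv SOA) (conj_Jpq AA) conj_proj_first eP -/(refl_mx _) refl_mxK.
rewrite mulmxBl mul1mx opprB addrC subrK -scalemxAl -scalemxAr Pg scalerA.
by rewrite mulfV ?two_neq0 // scale1r -surjective_pairing.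
Qed.

(** ** Parametrizations of S_p by graphs *)

Section GraphParam.
Variable B : basis_mx R n.
Local Notation T := (usubmx (invmx (sval B))).
Local Notation D := (dsubmx (invmx (sval B))).

Definition graph_mx (A : 'M[R]_(q, p)) : 'M[R]_(n, p) :=
  sval B *m col_mx 1%:M A.

Lemma graph_mxT A : T *m graph_mx A = 1%:M.
Proof. by rewrite mul_usub_mx mulKmx ?(valP B) // col_mxKu. Qed.

Lemma graph_mxD A : D *m graph_mx A = A.
Proof. by rewrite mul_dsub_mx mulKmx ?(valP B) // col_mxKd. Qed.

Lemma graph_mx_free A : row_free (graph_mx A)^T.
Proof.
by apply/row_freeP; exists T^T; rewrite -trmx_mul graph_mxT trmx1.
Qed.

Definition graph_proj A : 'M[R]_n := orthoproj (graph_mx A)^T.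

Lemma graph_projT A :
  T *m graph_proj A *m T^T = invmx ((graph_mx A)^T *m graph_mx A).
Proof.
rewrite /graph_proj /orthoproj trmxK; move: (graph_mx A) (graph_mxT A) => N TN.
by rewrite !mulmxA TN mul1mx -mulmxA -trmx_mul TN trmx1 mulmx1.
Qed.

Lemma graph_projD A :
  D *m graph_proj A *m T^T = A *m invmx ((graph_mx A)^T *m graph_mx A).
Proof.
rewrite /graph_proj /orthoproj trmxK.
move: (graph_mx A) (graph_mxT A) (graph_mxD A) => N TN DN.
by rewrite !mulmxA DN -[LHS]mulmxA -trmx_mul TN trmx1 mulmx1.
Qed.

Lemma graph_gram_unit A : (graph_mx A)^T *m graph_mx A \in unitmx.
Proof. by have := gram_unitmx (graph_mx_free A); rewrite trmxK. Qed.

Definition vecA (u : 'rV[R]_(q * p + p)) : 'M[R]_(q, p) := vec_mx (lsubmx u).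
Definition vecx (u : 'rV[R]_(q * p + p)) : 'cV[R]_p := (rsubmx u)^T.

Definition sp_param (u : 'rV[R]_(q * p + p)) : E :=
  (refl_mx (graph_proj (vecA u)), graph_mx (vecA u) *m vecx u).

(** On the points [((1 - 2 P) J, Y)] of [S_p], this vanishes exactly when the
    image of [P] is not a graph over the span of the first [p] columns of [B],
    since [T *m P *m T^T] is the Gram matrix of the rows of [T *m P]. *)
Definition sp_minor (g : E) : R := \det (T *m sp_proj g *m T^T).

Definition sp_coord (g : E) : 'rV[R]_(q * p + p) :=
  row_mx (mxvec (D *m sp_proj g *m T^T *m invmx (T *m sp_proj g *m T^T)))
         (T *m g.2)^T.

Lemma sp_paramK u : sp_coord (sp_param u) = u.
Proof.
rewrite /sp_coord /sp_param /= sp_projK graph_projT graph_projD invmxK.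
rewrite mulmxKV ?graph_gram_unit // mulmxA graph_mxT mul1mx trmxK vec_mxK.
exact: hsubmxK.
Qed.

Lemma sp_minor_param u : sp_minor (sp_param u) != 0.
Proof.
rewrite /sp_minor /sp_param sp_projK graph_projT -unitfE -unitmxE unitmx_inv.
exact: graph_gram_unit.
Qed.

Lemma sp_param_proj u :
  symproj (graph_proj (vecA u)) /\
  (graph_proj (vecA u) :=: (graph_mx (vecA u))^T)%MS.
Proof.
by split; [exact/orthoproj_symproj/graph_mx_free|
           exact/orthoproj_eqmx/graph_mx_free].
Qed.

Lemma sp_param_in (p0 : (0 < p)%N) u : Sp_set R p q (sp_param u).
Proof.
have [sP eP] := sp_param_proj u; apply/(Sp_setP p0).
rewrite sp_projK /=; split=> //.
  by rewrite eP; apply/eqP/graph_mx_free.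
rewrite mulmxA; congr (_ *m _); apply: trmx_inj.
have [tP _] := sP; rewrite trmx_mul tP.
exact/orthoprojK/graph_mx_free.
Qed.

(** With [A] the matrix part of [sp_coord g], [graph_mx A] equals
    [P *m T^T *m (T *m P *m T^T)^-1], so its columns lie in the image of [P];
    there are [p] of them and they are independent, so they span it, and the
    uniqueness of the orthogonal projection identifies [P]. *)
Lemma sp_coordK (p0 : (0 < p)%N) g : Sp_set R p q g -> sp_minor g != 0 ->
  sp_param (sp_coord g) = g.
Proof.
move=> /(Sp_setP p0)[]; set P := sp_proj g => sP rP Pg m0.
have [tP PP] := sP.
have uC : T *m P *m T^T \in unitmx by rewrite unitmxE unitfE.
rewrite /sp_param /vecA /vecx row_mxKl row_mxKr mxvecK trmxK.
set A := D *m P *m T^T *m _.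
have NE : graph_mx A = P *m T^T *m invmx (T *m P *m T^T).
  have CE : col_mx T D *m (P *m T^T *m invmx (T *m P *m T^T)) = col_mx 1%:M A.
    by rewrite mul_col_mx !mulmxA mulmxV.
  by rewrite /graph_mx -CE vsubmxK mulKVmx ?(valP B).
have eN : (P :=: (graph_mx A)^T)%MS.
  apply: eqmx_sym; apply/eqmxP.
  have NP : ((graph_mx A)^T <= P)%MS.
    by rewrite NE -mulmxA trmx_mul tP submxMl.
  have [_ <-] := mxrank_leqif_eq NP.
  by rewrite rP (eqP (graph_mx_free A)).
have PE : graph_proj A = P by apply: orthoproj_uniq => //; exact: graph_mx_free.
rewrite PE refl_mxK [RHS]surjective_pairing; congr pair.
have /submxP[y ey] : (g.2^T <= (graph_mx A)^T)%MS.
  by rewrite -eN -Pg trmx_mul tP submxMl.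
have {ey} ey : g.2 = graph_mx A *m y^T.
  by rewrite -[g.2]trmxK ey trmx_mul trmxK.
by rewrite ey (mulmxA T) graph_mxT mul1mx.
Qed.

(** ** Smoothness *)

Lemma Ck_sp_proj k (U : set E) : open U -> Ck k U sp_proj.
Proof.
move=> oU.
apply: (@Ck_eq _ _ _ k U (fun g => 2^-1%:M + g.1 *m (- 2^-1 *: J))) => //.
  by move=> g _; rewrite /sp_proj scalerBr scalemx1 -scalemxAr scaleNr.
apply: CkD => //; first exact: Ck_cst.
by apply: Ck_mulmx => //; [exact: Ck_fst|exact: Ck_cst].
Qed.

Lemma Ck_sp_compress m l (C : 'M[R]_(m, n)) (C' : 'M[R]_(n, l)) k (U : set E) :
  open U -> Ck k U (fun g => C *m sp_proj g *m C').
Proof.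
move=> oU; apply: Ck_mulmx => //; last exact: Ck_cst.
by apply: Ck_mulmx => //; [exact: Ck_cst|exact: Ck_sp_proj].
Qed.

Lemma Ck_sp_minor k (U : set E) : open U -> Ck k U sp_minor.
Proof. by move=> oU; apply: Ck_det => //; exact: Ck_sp_compress. Qed.

Lemma sp_minor_open : open [set g | sp_minor g != 0].
Proof.
apply: (@open_comp _ _ sp_minor [set y | y != 0]); last exact: open_neq.
by move=> g _; exact: (Ck_sp_minor 0%N openT).
Qed.

Lemma Ck_sp_coord k (U : set E) : open U ->
  (forall g, U g -> sp_minor g != 0) -> Ck k U sp_coord.
Proof.
move=> oU U0; apply: Ck_row_mx => //.
  apply: (Ck_lin_mx mxvec) => //; apply: Ck_mulmx => //.
    exact: Ck_sp_compress.
  apply: Ck_invmx => //; last exact: Ck_sp_compress.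
  by move=> g /U0; rewrite unitmxE unitfE.
apply: (Ck_lin_mx trmx) => //.
by apply: Ck_mulmx => //; [exact: Ck_cst|exact: Ck_snd].
Qed.

Lemma Ck_graph_mx k : Ck k setT (fun u => graph_mx (vecA u)).
Proof.
apply: Ck_mulmx; [exact: openT|exact: Ck_cst|].
apply: Ck_col_mx; [exact: openT|exact: Ck_cst|].
apply: (Ck_lin_mx vec_mx); first exact: openT.
by apply: (Ck_lin_mx lsubmx); [exact: openT|exact: Ck_id].
Qed.

Lemma Ck_sp_param k : Ck k setT sp_param.
Proof.
have oT := @openT 'rV[R]_(q * p + p).
have CN := Ck_graph_mx k.
have CNt : Ck k setT (fun u => (graph_mx (vecA u))^T).
  exact: (Ck_lin_mx trmx).
apply: Ck_pair => //.
  apply: Ck_mulmx => //; last exact: Ck_cst.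
  apply: CkD => //; first exact: Ck_cst.
  have CP : Ck k setT (fun u => graph_proj (vecA u)).
    apply: Ck_mulmx => //; apply: Ck_mulmx => //.
      exact: (Ck_lin_mx trmx).
    apply: Ck_invmx => //.
      by move=> u _; exact/gram_unitmx/graph_mx_free.
    by apply: Ck_mulmx => //; exact: (Ck_lin_mx trmx).
  apply: (@Ck_eq _ _ _ k setT (fun u => (- 2) *: graph_proj (vecA u))) => //.
    by move=> u _; rewrite scaleNr.
  by apply: Ck_scale => //; exact: Ck_cst.
apply: Ck_mulmx => //; apply: (Ck_lin_mx trmx) => //.
by apply: (Ck_lin_mx rsubmx) => //; exact: Ck_id.
Qed.

(** ** The charts *)

Definition sp_chart (p0 : (0 < p)%N) : chart R (q * p + p) (Sp_set R p q) :=
  Chart setT (fun u => SigSub (mem_set (sp_param_in p0 u))).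

Lemma sp_chart_image (p0 : (0 < p)%N) :
  sp_chart p0 @` setT = set_val @^-1` [set g | sp_minor g != 0].
Proof.
apply/seteqP; split=> [_ [u _ <-]|s /= s0]; first exact: sp_minor_param.
exists (sp_coord (set_val s)) => //; apply: val_inj.
by apply: sp_coordK => //; exact: set_mem (valP s).
Qed.

(** The inverse [sp_coord] is already defined and smooth on an open set of the
    ambient space, which provides a single extension around all the points. *)
Lemma sp_chart_submanifold (p0 : (0 < p)%N) : submanifold_chart (sp_chart p0).
Proof.
split; first exact: openT.
- rewrite sp_chart_image; apply: open_comp sp_minor_open => s _.
  exact: set_val_continuous.
- exact: Ck_sp_param.
exists sp_coord => [u _|]; first exact: sp_paramK.
move=> _ [u _ <-]; exists [set g | sp_minor g != 0], sp_coord.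
split=> //; [exact: sp_minor_open|exact: sp_minor_param|].
by move=> k; apply: Ck_sp_coord => //; exact: sp_minor_open.
Qed.

End GraphParam.

(** * The diffeomorphism *)

Section Bundle.
Hypothesis p0 : (0 < p)%N.
Local Notation S := (Sp_set R p q).

Definition sp_space (s : S) : {vspace 'cV[R]_n} :=
  limg (linfun (mulmx (sp_proj (set_val s)) : 'cV[R]_n -> 'cV[R]_n)).

Lemma dim_sp_space s : \dim (sp_space s) = p.
Proof.
by rewrite dim_limg_mulmx; have /(Sp_setP p0)[] := set_mem (valP s).
Qed.

Definition sp_point (s : S) : Grassmannian R n p :=
  SigSub (mem_set (dim_sp_space s)).

Lemma sp_point_taut s : taut_set R n p (sp_point s, (set_val s).2).
Proof.
have /(Sp_setP p0)[_ _ Pg] := set_mem (valP s).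
apply/memv_imgP; exists (set_val s).2; first exact: memvf.
by rewrite lfunE /= Pg.
Qed.

Definition to_bundle (s : S) : taut_space R p q :=
  SigSub (mem_set (sp_point_taut s)).

Lemma to_bundle_sp_chart B u : to_bundle (sp_chart B p0 u) = taut_chart B u.
Proof.
apply: val_inj; congr pair; apply: val_inj => /=.
have [[tP _] eP] := sp_param_proj B u.
by apply: eq_limg_mulmx; rewrite sp_projK tP.
Qed.

(** A subspace determines the orthogonal projection onto it. *)
Lemma to_bundle_inj : injective to_bundle.
Proof.
move=> s t /(congr1 val)[eV eX]; apply: val_inj.
have /(Sp_setP p0)[sP _ _] := set_mem (valP s).
have /(Sp_setP p0)[sQ _ _] := set_mem (valP t).
rewrite [LHS]surjective_pairing [RHS]surjective_pairing; congr pair => //.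
rewrite -[LHS]refl_mxK -[RHS]refl_mxK; congr refl_mx.
apply: symproj_eqmx => //; have [tP _] := sP; have [tQ _] := sQ.
by rewrite -tP -tQ; exact: limg_mulmx_inj.
Qed.

(** The charts given by matrices of [SO n] suffice: if the first [p] columns of
    such a matrix span [V], then [V] is the graph of [0] in its chart. *)
Lemma taut_chart_cover (x : taut_space R p q) :
  exists B u, taut_chart B u = x.
Proof.
have xin := set_mem (valP x).
have dV := set_mem (valP (val x).1).
have [K VK] := vspace_limg_mulmx (val (val x).1).
have rK : \rank K^T = p by rewrite mxrank_tr -dim_limg_mulmx -VK.
have [N fN eN] := row_free_base_of_rank rK.
have [A [AA dA eA]] := SO_completion p0 fN.
have uA : A \in unitmx by rewrite unitmxE dA unitr1.
pose B : basis_mx R n := exist _ A uA.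
have VE : graph_space B 0 = val (val x).1.
  rewrite VK; apply: eq_limg_mulmx => /=.
  rewrite trmx_mul tr_col_mx trmx0 trmx1.
  rewrite -{1}(vsubmxK A^T) mul_row_col mul1mx mul0mx addr0.
  exact: eqmx_trans eA eN.
have : (val x).2 \in graph_space B 0 by rewrite VE.
move=> /memv_imgP[y _ ey].
exists B, (row_mx (mxvec 0) y^T); apply: val_inj => /=.
rewrite row_mxKl row_mxKr mxvecK trmxK [RHS]surjective_pairing; congr pair.
  exact: val_inj.
by rewrite ey lfunE.
Qed.

Lemma to_bundle_surj (x : taut_space R p q) : exists s, to_bundle s = x.
Proof.
have [B [u <-]] := taut_chart_cover x.
by exists (sp_chart B p0 u); exact: to_bundle_sp_chart.
Qed.

Definition of_bundle (x : taut_space R p q) : S :=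
  projT1 (cid (to_bundle_surj x)).

Lemma of_bundleK : cancel of_bundle to_bundle.
Proof. by move=> x; exact: projT2 (cid (to_bundle_surj x)). Qed.

Lemma to_bundleK : cancel to_bundle of_bundle.
Proof. exact: inj_can_sym of_bundleK to_bundle_inj. Qed.

Lemma of_bundle_taut_chart B u : of_bundle (taut_chart B u) = sp_chart B p0 u.
Proof. by rewrite -to_bundle_sp_chart to_bundleK. Qed.

Lemma sp_chart_cover (s : S) : exists B u, sp_chart B p0 u = s.
Proof.
have [B [u e]] := taut_chart_cover (to_bundle s).
by exists B, u; apply: to_bundle_inj; rewrite to_bundle_sp_chart.
Qed.

Lemma Sp_manifold : smooth_manifold (Sp R p q).
Proof.
apply: (submanifold_smooth pair_coord_continuous pair_coordE
  (@ratr_pair_dense R _ _ _)) => s.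
have [B [u <-]] := sp_chart_cover s.
by exists (sp_chart B p0); [exact: sp_chart_submanifold|exists u].
Qed.

(** The topology of the bundle is the final one for its charts, and these become
    the continuous maps [sp_chart]. *)
Lemma of_bundle_continuous : continuous of_bundle.
Proof.
apply/continuousP => W oW; change (taut_open (of_bundle @^-1` W)) => B.
rewrite (_ : _ @^-1` _ = sp_chart B p0 @^-1` W).
  apply: open_comp oW => u _.
  have [_ _ cB _] := submanifold_chart_homeo (sp_chart_submanifold B p0).
  exact: cB.
by apply/seteqP; split=> u /=; rewrite of_bundle_taut_chart.
Qed.

(** The charts [sp_chart] are open maps that cover [S_p]. *)
Lemma to_bundle_continuous : continuous to_bundle.
Proof.
apply/continuousP => W oW; have {}oW : taut_open W := oW.
rewrite (_ : _ @^-1` _ = \bigcup_B (sp_chart B p0 @` (taut_chart B @^-1` W))).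
  apply: bigcup_open => B _.
  have [_ _ _ oB] := submanifold_chart_homeo (sp_chart_submanifold B p0).
  exact: oB (oW B) _.
apply/seteqP; split=> [s Ws|_ [B _ [u Wu <-]]].
  have [B [u e]] := sp_chart_cover s; exists B => //; exists u => //.
  by change (W (taut_chart B u)); rewrite -to_bundle_sp_chart e.
by change (W (to_bundle (sp_chart B p0 u))); rewrite to_bundle_sp_chart.
Qed.

Lemma push_taut_chart B :
  push_chart of_bundle (taut_chart B) = sp_chart B p0.
Proof. by congr Chart; apply/funext => u; exact: of_bundle_taut_chart. Qed.

End Bundle.

End SpBundle.

Theorem lemma3 (R : realType) (p q : nat) (hp : (0 < p)%N) (hq : (0 < q)%N) :
  diffeomorphic (Sp R p q) (canonical_bundle R p q).
Proof.
apply: (@transport_diffeomorphic _ _ (Sp R p q) (canonical_bundle R p q)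
  (to_bundle hp) (of_bundle hp) (Sp_manifold hp) (to_bundleK hp)
  (of_bundleK hp) (@to_bundle_continuous _ _ _ hp)
  (@of_bundle_continuous _ _ _ hp)).
  by move=> _ [B _ <-]; rewrite push_taut_chart; exact: sp_chart_submanifold.
move=> x; have [B [u <-]] := taut_chart_cover hp x.
by exists (taut_chart B); [exists B|exists u].
Qed.
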